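(* Let $K$ be an infinite field of characteristic $p\ge 5$. Every nonzero T-space $U$ of the algebra $F_2^{(3)}$ that is contained in the commutator ideal $T^{(2)}=T^{(2)}(F_2^{(3)})$ is generated, as a T-space, by the element $[x,y]$ together with the special polynomials belonging to $U$.
   Context: $F_2$ is the free unital associative $K$-algebra on $x,y$; $[a,b]=ab-ba$, $[a,b,c]=[[a,b],c]$. $F_2^{(3)}$ is the quotient of $F_2$ by the two-sided ideal generated by all $[a,b,c]$, $a,b,c\in F_2$. $T^{(2)}(F_2^{(3)})$ is the two-sided ideal of $F_2^{(3)}$ generated by all $[a,b]$. A T-space of $F_2^{(3)}$ is a $K$-subspace closed under all unital algebra endomorphisms of $F_2^{(3)}$; the T-space generated by a set $S$ is the smallest T-space containing $S$. For integers $q_1,q_2\ge1$ put $f(q_1,q_2)=[x,y]x^{q_1-1}y^{q_2-1}\in F_2^{(3)}$. The polynomial $f(q_1,q_2)$ is called special if $q_1,q_2\in\{p^s: s\ge1\}$. *)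

(* Defs.v *)
From HB Require Import structures.
From mathcomp Require Import all_boot all_algebra.
From mathcomp Require Import boolp classical_sets cardinality.
From mathcomp Require Import finmap monalg.

Set Implicit Arguments.
Unset Strict Implicit.
Unset Printing Implicit Defensive.

Import GRing.Theory.
Local Open Scope classical_set_scope.
Local Open Scope ring_scope.
Local Open Scope quotient_scope.

(* Commutators are left-normed: [a, b, c] = [[a, b], c]. *)
Definition commutator (R : nzRingType) (a b : R) : R := a * b - b * a.

Definition commutators2 (R : nzRingType) : set R :=
  [set r | exists a b, r = commutator a b].

Definition commutators3 (R : nzRingType) : set R :=
  [set r | exists a b c, r = commutator (commutator a b) c].

Arguments commutators2 R : clear implicits.
Arguments commutators3 R : clear implicits.

Definition is_ideal (R : nzRingType) (I : set R) : Prop :=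
  [/\ I 0,
      forall a b, I a -> I b -> I (a - b),
      forall r a, I a -> I (r * a) &
      forall r a, I a -> I (a * r)].

Definition ideal_gen (R : nzRingType) (S : set R) : set R :=
  smallest (@is_ideal R) S.

Lemma ideal_genP (R : nzRingType) (S : set R) : is_ideal (ideal_gen S).
Proof.
split=> [J [[]//]|a b Ia Ib J SJ|r a Ia J SJ|r a Ia J SJ];
  case: (SJ) => -[_ JB Jl Jr] _.
- by apply: JB; [exact: (Ia J SJ)|exact: (Ib J SJ)].
- exact/Jl/(Ia J SJ).
- exact/Jr/(Ia J SJ).
Qed.

(* The free unital associative algebra K<x, y>: the monoid algebra of the free
   monoid (words) on two letters. *)
Definition F2 (K : fieldType) := {malg K[{fmonom 'I_2}]}.
HB.instance Definition _ (K : fieldType) := GRing.Lalgebra.on (F2 K).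

Section RelativelyFree.
Variable K : fieldType.

Definition T3 : set (F2 K) := ideal_gen (commutators3 (F2 K)).

(* MathComp quotients are taken by boolean predicates. *)
Definition T3b (a : F2 K) : bool := `[< T3 a >].

Lemma T3b_zmod_closed : zmod_closed T3b.
Proof.
have [I0 IB _ _] := ideal_genP (commutators3 (F2 K)).
split; first by apply/asboolP; exact: I0.
by move=> a b /asboolP Ia /asboolP Ib; apply/asboolP; exact: IB.
Qed.

HB.instance Definition _ := GRing.isZmodClosed.Build (F2 K) T3b T3b_zmod_closed.

Lemma T3bMl r a : a \in T3b -> r * a \in T3b.
Proof.
move=> /asboolP Ia; apply/asboolP.
by have [_ _ Ml _] := ideal_genP (commutators3 (F2 K)); exact: Ml.
Qed.

Lemma T3bMr r a : a \in T3b -> a * r \in T3b.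
Proof.
move=> /asboolP Ia; apply/asboolP.
by have [_ _ _ Mr] := ideal_genP (commutators3 (F2 K)); exact: Mr.
Qed.

(* Properness: T3 lies in the kernel of the augmentation x, y |-> 0. *)
Lemma T3b1 : 1 \notin T3b.
Proof.
pose eps : {rmorphism {malg K[{fmonom 'I_2}]} -> K} :=
  @mcoeff {fmonom 'I_2} K (@mone {fmonom 'I_2}).
apply/negP => /asboolP /(_ [set a : F2 K | eps a = 0]) /=.
rewrite rmorph1 => H; move/eqP: (oner_neq0 K); apply; apply: H; split.
  split=> [|a b /= a0 b0|r a /= a0|r a /= a0]; first exact: raddf0.
  - by rewrite raddfB /= a0 b0 subr0.
  - by rewrite rmorphM /= a0 mulr0.
  - by rewrite rmorphM /= a0 mul0r.
by move=> _ [a [b [c ->]]] /=; rewrite /commutator rmorphB !rmorphM /= mulrC subrr.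
Qed.

Definition T3I : zmodClosed (F2 K) := GRing.ZmodClosed.clone _ T3b _.

(* F_2^(3) = K<x, y> / T3; its ring and K-algebra structures are transported
   along the canonical surjection pi23 below. *)
Definition F23 := Quotient.quot T3I.

HB.instance Definition _ := EqQuotient.on F23.
HB.instance Definition _ := GRing.Zmodule.on F23.
HB.instance Definition _ := ZmodQuotient.on F23.

Definition pi23 : F2 K -> F23 := \pi_F23.

Lemma pi23P (u : F23) : exists a, u = pi23 a.
Proof. by exists (repr u); rewrite /pi23 reprK. Qed.

Lemma pi23_eqP (a b : F2 K) : reflect (pi23 a = pi23 b) (a - b \in T3b).
Proof. by rewrite Quotient.idealrBE; apply: eqP. Qed.

Lemma pi23_zmod_morphism : zmod_morphism pi23.
Proof. exact: (raddfB \pi_F23). Qed.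

HB.instance Definition _ :=
  GRing.isZmodMorphism.Build (F2 K) F23 pi23 pi23_zmod_morphism.

Definition one23 : F23 := lift_cst F23 1.
Definition mul23 := lift_op2 F23 *%R.
Definition scale23 (c : K) := lift_op1 F23 (fun a : F2 K => c *: a).

Lemma pi23_one : pi23 1 = one23. Proof. by rewrite /one23; unlock. Qed.

Lemma pi23_mul : {morph pi23 : a b / a * b >-> mul23 a b}.
Proof.
move=> a b; rewrite /mul23; unlock; apply/pi23_eqP.
set a' := repr _; set b' := repr _.
have -> : a * b - a' * b' = (a - a') * b + a' * (b - b').
  by rewrite mulrBl mulrBr addrA subrK.
by rewrite rpredD //; [apply: T3bMr|apply: T3bMl]; apply/pi23_eqP;
  rewrite /pi23 reprK.
Qed.

Lemma pi23_scale c : {morph pi23 : a / c *: a >-> scale23 c a}.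
Proof.
move=> a; rewrite /scale23; unlock; apply/pi23_eqP.
by rewrite -scalerBr -mul_malgC; apply/T3bMl/pi23_eqP; rewrite /pi23 reprK.
Qed.

Lemma F23_mulA : associative mul23.
Proof.
move=> u v w; have [[a ->] [b ->] [c ->]] := And3 (pi23P u) (pi23P v) (pi23P w).
by rewrite -!pi23_mul mulrA.
Qed.

Lemma F23_mul1l : left_id one23 mul23.
Proof. by move=> u; have [a ->] := pi23P u; rewrite -pi23_one -pi23_mul mul1r. Qed.

Lemma F23_mul1r : right_id one23 mul23.
Proof. by move=> u; have [a ->] := pi23P u; rewrite -pi23_one -pi23_mul mulr1. Qed.

Lemma F23_mulDl : left_distributive mul23 +%R.
Proof.
move=> u v w; have [[a ->] [b ->] [c ->]] := And3 (pi23P u) (pi23P v) (pi23P w).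
by rewrite -raddfD -!pi23_mul -raddfD mulrDl.
Qed.

Lemma F23_mulDr : right_distributive mul23 +%R.
Proof.
move=> u v w; have [[a ->] [b ->] [c ->]] := And3 (pi23P u) (pi23P v) (pi23P w).
by rewrite -raddfD -!pi23_mul -raddfD mulrDr.
Qed.

Lemma F23_one_neq0 : one23 != 0.
Proof.
rewrite -pi23_one -[0](raddf0 pi23); apply/eqP => /pi23_eqP.
by rewrite subr0 (negPf T3b1).
Qed.

HB.instance Definition _ := GRing.Zmodule_isNzRing.Build F23
  F23_mulA F23_mul1l F23_mul1r F23_mulDl F23_mulDr F23_one_neq0.

Lemma F23_scaleA c d u : scale23 c (scale23 d u) = scale23 (c * d) u.
Proof. by have [a ->] := pi23P u; rewrite -!pi23_scale scalerA. Qed.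

Lemma F23_scale1 : left_id 1 scale23.
Proof. by move=> u; have [a ->] := pi23P u; rewrite -pi23_scale scale1r. Qed.

Lemma F23_scaleDr : right_distributive scale23 +%R.
Proof.
move=> c u v; have [[a ->] [b ->]] := conj (pi23P u) (pi23P v).
by rewrite -raddfD -!pi23_scale -raddfD scalerDr.
Qed.

Lemma F23_scaleDl u : {morph scale23^~ u : c d / c + d}.
Proof.
by move=> c d; have [a ->] := pi23P u; rewrite -!pi23_scale -raddfD scalerDl.
Qed.

HB.instance Definition _ := GRing.Zmodule_isLmodule.Build K F23
  F23_scaleA F23_scale1 F23_scaleDr F23_scaleDl.

Lemma pi23_monoid_morphism : monoid_morphism pi23.
Proof. by split; [exact: pi23_one|exact: pi23_mul]. Qed.

HB.instance Definition _ :=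
  GRing.isMonoidMorphism.Build (F2 K) F23 pi23 pi23_monoid_morphism.
HB.instance Definition _ :=
  GRing.isScalable.Build K (F2 K) F23 *:%R pi23 pi23_scale.

Lemma F23_scaleAl (c : K) (u v : F23) : c *: (u * v) = (c *: u) * v.
Proof.
have [[a ->] [b ->]] := conj (pi23P u) (pi23P v).
by rewrite -rmorphM -!linearZ -rmorphM scalerAl.
Qed.

HB.instance Definition _ := GRing.Lmodule_isLalgebra.Build K F23 F23_scaleAl.

Lemma F2_scaleAr (c : K) (a b : F2 K) : c *: (a * b) = a * (c *: b).
Proof.
have cC : malgC c * a = a * malgC c.
  rewrite mul_malgC malgM_def fgmulgU malgZ_def.
  by apply: eq_bigr => k _; rewrite mulm1 mulrC.
by rewrite -!mul_malgC mulrA cC mulrA.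
Qed.

Lemma F23_scaleAr (c : K) (u v : F23) : c *: (u * v) = u * (c *: v).
Proof.
have [[a ->] [b ->]] := conj (pi23P u) (pi23P v).
by rewrite -rmorphM -!linearZ -rmorphM F2_scaleAr.
Qed.

HB.instance Definition _ := GRing.Lalgebra_isAlgebra.Build K F23 F23_scaleAr.

End RelativelyFree.

Arguments T3 K : clear implicits.

(* {lrmorphism A -> A} is the type of unital K-algebra endomorphisms. *)
Definition Tspace (K : fieldType) (A : algType K) (U : set A) : Prop :=
  [/\ U 0,
      forall (c : K) u v, U u -> U v -> U (c *: u + v) &
      forall (phi : {lrmorphism A -> A}) u, U u -> U (phi u)].

Definition Tspace_gen (K : fieldType) (A : algType K) (S : set A) : set A :=
  smallest (@Tspace K A) S.

Definition T2 (K : fieldType) : set (F23 K) :=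
  ideal_gen (commutators2 (F23 K)).

Arguments T2 K : clear implicits.

(* The images of the generators x and y in F_2^(3). *)
Definition xF (K : fieldType) : F23 K := pi23 << fmu (ord0 : 'I_2) >>.
Definition yF (K : fieldType) : F23 K := pi23 << fmu (ord_max : 'I_2) >>.

Arguments xF K : clear implicits.
Arguments yF K : clear implicits.

(* Meant for q1, q2 >= 1, where the predecessor is not truncated. *)
Definition fpoly (K : fieldType) (q1 q2 : nat) : F23 K :=
  commutator (xF K) (yF K) * xF K ^+ q1.-1 * yF K ^+ q2.-1.

Definition special (K : fieldType) (p : nat) : set (F23 K) :=
  [set g | exists s t, [/\ (1 <= s)%N, (1 <= t)%N &
     g = fpoly K (p ^ s) (p ^ t)]].

(* Main.v *)
Require Import Defs.
From HB Require Import structures.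
From mathcomp Require Import all_boot all_algebra.
From mathcomp Require Import boolp classical_sets cardinality.
From mathcomp Require Import finmap monalg.
From mathcomp Require Import ring.

Set Implicit Arguments.
Unset Strict Implicit.
Unset Printing Implicit Defensive.

Import GRing.Theory.
Local Open Scope classical_set_scope.
Local Open Scope ring_scope.

(** In F_2^(3) the commutator w = [x,y] is central with w^2 = 0, so T^(2) is
    spanned by the polynomials f(i,j) = w x^(i-1) y^(j-1).  Since K is
    infinite, rescaling x and y makes a T-space U inside T^(2) homogeneous: it
    is spanned by the f(i,j) it contains.  If p does not divide i, then
    i f(i,j) = [x^i y^(j-1), y] already lies in the T-space of w, and
    similarly for j.  Otherwise i = p^a m and j = p^b n with a, b >= 1 and m, n
    prime to p.  Substituting x + 1 and y + 1 and extracting a component gives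
    the special polynomial f(p^a,p^b), because the binomial coefficient
    C(p^a m - 1, p^a - 1) is 1 modulo p; conversely, substituting x^m and y^n
    in f(p^a,p^b) gives back mn f(p^a m, p^b n).  The same translation argument
    puts w itself in every nonzero U. *)

(** * Coefficient extraction over an infinite field, and a binomial congruence *)

Lemma infinite_field_inj (K : fieldType) (n : nat) :
  infinite_set [set: K] -> exists t : 'I_n -> K, injective t.
Proof.
move=> /infinite_set_fset -/(_ n)[B _ nB].
exists (fun i : 'I_n => nth 0 (enum_fset B) i) => i j /eqP.
rewrite nth_uniq ?fset_uniq //; first by move/eqP/val_inj.
  exact: leq_trans nB.
exact: leq_trans nB.
Qed.

(** At n distinct scalars [t j] the Vandermonde matrix is invertible, so each [v i] is a linear
    combination of n values of the pencil; column i of the inverse matrix supplies the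
    coefficients. *)
Lemma pencil_coef_mem (K : fieldType) (V : lmodType K) (W : set V) (n : nat)
    (v : nat -> V) :
  infinite_set [set: K] ->
  W 0 -> (forall (c : K) a b, W a -> W b -> W (c *: a + b)) ->
  (forall t : K, W (\sum_(i < n) t ^+ i *: v i)) ->
  forall i, (i < n)%N -> W (v i).
Proof.
move=> /(infinite_field_inj n)[t t_inj] W0 WD Wt i lt_in.
pose M := Vandermonde n (\row_j t j).
have M_unit : M \in unitmx.
  rewrite unitmxE det_Vandermonde unitfE; apply/prodf_neq0 => j _.
  apply/prodf_neq0 => k ltjk; rewrite !mxE subr_eq0.
  by apply: contraTN ltjk => /eqP /t_inj ->; rewrite ltnn.
have -> : v i = \sum_(j < n) invmx M j (Ordinal lt_in) *:
                   \sum_(k < n) t j ^+ k *: v k.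
  under eq_bigr do rewrite scaler_sumr.
  rewrite exchange_big /=.
  rewrite (eq_bigr (fun k : 'I_n => (k == Ordinal lt_in)%:R *: v k)).
    rewrite (bigD1 (Ordinal lt_in)) //= eqxx scale1r big1 ?addr0 // => k.
    by move=> /negPf ->; rewrite scale0r.
  move=> k _; under eq_bigr do rewrite scalerA.
  rewrite -scaler_suml; congr (_ *: _).
  have := congr1 (fun A : 'M_n => A k (Ordinal lt_in)) (mulmxV M_unit).
  rewrite !mxE => <-; apply: eq_bigr => j _; rewrite !mxE mulrC //.
elim/big_rec: _ => // j w _ Ww; exact: WD.
Qed.

(** With q = p^a, the polynomial (1+X)^(qm+q-1) equals (1+X^q)^m (1+X)^(q-1) in characteristic p.
    Modulo X^q the first factor is 1, so the coefficient of X^(q-1) is C(q-1,q-1) = 1. *)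
Lemma bin_pexp_pred (K : fieldType) (p a m : nat) : p \in [pchar K] ->
  ('C((p ^ a * m.+1).-1, (p ^ a).-1))%:R = 1 :> K.
Proof.
move=> pK; have p_pr := pcharf_prime pK; set q := (p ^ a)%N.
have q_gt0 : (0 < q)%N by rewrite expn_gt0 prime_gt0.
have -> : ((q * m.+1).-1 = q * m + q.-1)%N.
  by rewrite mulnS addnC -subn1 -addnBA // subn1.
have coefD1 n i : ((1 + 'X : {poly K}) ^+ n)`_i = 'C(n, i)%:R.
  rewrite addrC exprD1n coef_sum; under eq_bigr do rewrite coefMn coefXn.
  have [lt_in|lt_ni] := ltnP i n.+1.
    rewrite (bigD1 (Ordinal lt_in)) //= eqxx big1 ?addr0 // => j.
    by rewrite -val_eqE eq_sym /= => /negPf ->; rewrite mul0rn.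
  rewrite bin_small // big1 // => j _.
  by rewrite gtn_eqF ?mul0rn //; exact: leq_trans lt_ni.
rewrite -coefD1 exprD exprM.
have -> : (1 + 'X : {poly K}) ^+ q = 1 + 'X^q.
  rewrite exprDn_pchar ?expr1n //.
  by rewrite pnatX pnatE // pchar_poly pK.
have [r ->] : exists r : {poly K}, (1 + 'X^q) ^+ m = 1 + 'X^q * r.
  elim: m => [|m [r IH]]; first by exists 0; rewrite mulr0 addr0.
  exists (1 + r + 'X^q * r); rewrite exprS IH; ring.
rewrite mulrDl mul1r -mulrA coefD coefXnM ltn_predL q_gt0 addr0 coefD1.
by rewrite binn.
Qed.

(** * Commutator calculus in arbitrary rings and algebras *)

Lemma commutatorMl (R : nzRingType) (a b c : R) :
  commutator (a * b) c = a * commutator b c + commutator a c * b.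
Proof. by rewrite /commutator mulrBr mulrBl !mulrA addrA subrK. Qed.

Lemma commutatorMr (R : nzRingType) (a b c : R) :
  commutator a (b * c) = commutator a b * c + b * commutator a c.
Proof. by rewrite /commutator mulrBr mulrBl !mulrA addrA subrK. Qed.

Lemma commutatorxx (R : nzRingType) (a : R) : commutator a a = 0.
Proof. exact: subrr. Qed.

Lemma commutator1x (R : nzRingType) (a : R) : commutator 1 a = 0.
Proof. by rewrite /commutator mulr1 mul1r subrr. Qed.

Lemma commutatorDl (R : nzRingType) (a b c : R) :
  commutator (a + b) c = commutator a c + commutator b c.
Proof. by rewrite /commutator mulrDr mulrDl opprD addrACA. Qed.

Lemma commutatorC (R : nzRingType) (a b : R) :
  commutator a b = - commutator b a.
Proof. by rewrite /commutator opprB. Qed.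

Lemma commutatorZl (K : fieldType) (R : algType K) (c : K) (a b : R) :
  commutator (c *: a) b = c *: commutator a b.
Proof. by rewrite /commutator -scalerAl -scalerAr -scalerBr. Qed.

Lemma commutatorZr (K : fieldType) (R : algType K) (c : K) (a b : R) :
  commutator a (c *: b) = c *: commutator a b.
Proof. by rewrite commutatorC commutatorZl commutatorC scalerN opprK. Qed.

Lemma rmorph_commutator (R S : nzRingType) (f : {rmorphism R -> S}) (a b : R) :
  f (commutator a b) = commutator (f a) (f b).
Proof. by rewrite /commutator rmorphB !rmorphM. Qed.

(** * Generators and endomorphisms of F_2^(3) *)

Section Endo.
Variable K : fieldType.
Local Notation A := (F23 K).

Lemma monalgM (I : choiceType) (k l : {fmonom I}) :
  << k >> * << l >> = << mmul k l >> :> {malg K[{fmonom I}]}.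
Proof. by rewrite malgM_def fgmulUU mulr1. Qed.

(** Every element is the image of a linear combination of words, and a word is a product of
    letters. *)
Lemma F23_ind (P : A -> Prop) :
  P 1 -> P (xF K) -> P (yF K) ->
  (forall (c : K) a b, P a -> P b -> P (c *: a + b)) ->
  (forall a b, P a -> P b -> P (a * b)) -> forall a, P a.
Proof.
move=> P1 Px Py PD PM a.
have P0 : P 0 by rewrite -(addNr 1) -scaleN1r; exact: PD.
have [g ->] := pi23P a; rewrite [g](monalgEw (fsubset_refl _)) raddf_sum.
elim/big_rec: _ => // k b _ Pb.
have -> : << g@_k *g k >> = g@_k *: (<< k >> : F2 K).
  by apply/malgP => x; rewrite mcoeffZ 2!mcoeffU mulrnAr mulr1.
rewrite /= linearZ; apply: PD => //.
case: k => s; elim: s => [|i s IHs].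
  by rewrite -fmoneE (rmorph1 (@pi23 K)).
have -> : << FMonom (i :: s) >> = << fmu i >> * << FMonom s >> :> F2 K.
  rewrite [RHS]monalgM; congr << _ >>; apply/val_inj; rewrite /= fmM fmU //.
rewrite rmorphM; apply: PM => //.
have [-> | ->] : i = ord0 \/ i = ord_max; last 2 first.
- exact: Px.
- exact: Py.
by case: i => -[|[|i]] // lti; [left|right]; exact: val_inj.
Qed.

Lemma commutator3_eq0 (a b c : A) : commutator (commutator a b) c = 0.
Proof.
have [[a' ->] [b' ->] [c' ->]] := And3 (pi23P a) (pi23P b) (pi23P c).
rewrite -!rmorph_commutator -(raddf0 (@pi23 K)).
apply/pi23_eqP; rewrite subr0; apply/asboolP => J [_]; apply.
by exists a', b', c'.
Qed.

Definition word_eval (u v : A) (m : {fmonom 'I_2}) : A :=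
  \prod_(i <- m) (if i == ord0 then u else v).

Lemma word_eval_mmorphism u v : mmorphism (word_eval u v).
Proof.
split=> [m n|]; rewrite /word_eval; first by rewrite fmM big_cat.
by rewrite fm1 big_nil.
Qed.

HB.instance Definition _ u v :=
  isMultiplicative.Build _ A (word_eval u v) (word_eval_mmorphism u v).

Definition F2_eval (u v : A) : F2 K -> A := mmap (in_alg A) (word_eval u v).

Lemma F2_eval_zmod_morphism u v : zmod_morphism (F2_eval u v).
Proof. exact: mmapB. Qed.

HB.instance Definition _ u v :=
  GRing.isZmodMorphism.Build (F2 K) A (F2_eval u v) (F2_eval_zmod_morphism u v).

Lemma F2_eval_monoid_morphism u v : monoid_morphism (F2_eval u v).
Proof.
have [] := @commr_mmap_is_multiplicative {fmonom 'I_2} K A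
  (in_alg A) (word_eval u v) _ => //.
by move=> g m m'; rewrite /GRing.comm /= mulr_algl mulr_algr.
Qed.

HB.instance Definition _ u v := GRing.isMonoidMorphism.Build (F2 K) A
  (F2_eval u v) (F2_eval_monoid_morphism u v).

Lemma F2_evalZ u v : scalable (F2_eval u v).
Proof. by move=> c a; rewrite /F2_eval mmapZ /= mulr_algl. Qed.

Lemma F2_evalU u v i : F2_eval u v << fmu i >> = if i == ord0 then u else v.
Proof. by rewrite /F2_eval mmapU /= scale1r mul1r /word_eval fmU big_seq1. Qed.

Lemma F2_eval_T3 u v a : T3 K a -> F2_eval u v a = 0.
Proof.
move=> /(_ [set a : F2 K | F2_eval u v a = 0]); apply; split.
  split=> [|b c /= b0 c0|r b /= b0|r b /= b0]; first exact: raddf0.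
  - by rewrite raddfB /= b0 c0 subr0.
  - by rewrite rmorphM /= b0 mulr0.
  - by rewrite rmorphM /= b0 mul0r.
move=> _ [b [c [d ->]]] /=.
by rewrite !rmorph_commutator; exact: commutator3_eq0.
Qed.

(** The choice of representative is harmless, because evaluation kills [T3]. *)
Definition F23_eval (u v : A) (a : A) : A := F2_eval u v (repr a).

Lemma F23_eval_pi u v a : F23_eval u v (pi23 a) = F2_eval u v a.
Proof.
apply/eqP; rewrite -subr_eq0 -raddfB; apply/eqP/F2_eval_T3/asboolP/pi23_eqP.
by rewrite /pi23 reprK.
Qed.

(** Relative freeness: evaluating words in [A] sends triple commutators to triple commutators, which
    vanish in [A], so the evaluation factors through the quotient. *)
Lemma F23_endo_exists (u v : A) : exists phi : {lrmorphism A -> A},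
  phi (xF K) = u /\ phi (yF K) = v.
Proof.
have evB : zmod_morphism (F23_eval u v).
  move=> a b; have [[a' ->] [b' ->]] := conj (pi23P a) (pi23P b).
  by rewrite -raddfB !F23_eval_pi raddfB.
have evM : monoid_morphism (F23_eval u v).
  split=> [|a b]; first by rewrite -(rmorph1 (@pi23 K)) F23_eval_pi !rmorph1.
  have [[a' ->] [b' ->]] := conj (pi23P a) (pi23P b).
  by rewrite -rmorphM !F23_eval_pi rmorphM.
have evZ : scalable (F23_eval u v).
  move=> c a; have [a' ->] := pi23P a.
  by rewrite -linearZ !F23_eval_pi F2_evalZ.
pose evBM := GRing.isZmodMorphism.Build A A (F23_eval u v) evB.
pose evMM := GRing.isMonoidMorphism.Build A A (F23_eval u v) evM.
pose evZM := GRing.isScalable.Build K A A *:%R (F23_eval u v) evZ.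
pose phi : {lrmorphism A -> A} := HB.pack (F23_eval u v) evBM evMM evZM.
by exists phi; rewrite /= !F23_eval_pi !F2_evalU.
Qed.

End Endo.

(** * The commutator ideal and its spanning polynomials *)

Section CommutatorIdeal.
Variable K : fieldType.
Local Notation A := (F23 K).
Local Notation x := (xF K).
Local Notation y := (yF K).
Local Notation w := (commutator x y).

Lemma commutator_central (a b c : A) :
  commutator a b * c = c * commutator a b.
Proof. by apply/eqP; rewrite -subr_eq0; apply/eqP/commutator3_eq0. Qed.

Lemma commutatorXl (a b : A) n :
  commutator (a ^+ n) b = (commutator a b * a ^+ n.-1) *+ n.
Proof.
elim: n => [|[|n] IHn]; rewrite ?commutator1x ?mulr1 ?expr1 ?mulr0n //.
rewrite exprS commutatorMl IHn -mulrnAr mulrA -commutator_central -mulrA /=.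
by rewrite mulrnAr -exprS mulrnAr -mulrSr.
Qed.

Lemma commutatorXr (a b : A) n :
  commutator a (b ^+ n) = (commutator a b * b ^+ n.-1) *+ n.
Proof.
by rewrite commutatorC commutatorXl [commutator b a]commutatorC mulNr mulNrn
           opprK.
Qed.

(** Since [a,ab] = a[a,b], the Leibniz rule expands 0 = [[a,ab],b] as a[[a,b],b] + [a,b]^2, and the
    first term vanishes. *)
Lemma commutator_sqr0 (a b : A) : commutator a b * commutator a b = 0.
Proof.
have := commutator3_eq0 a (a * b) b.
rewrite commutatorMr commutatorxx mul0r add0r commutatorMl commutator3_eq0.
by rewrite mulr0 add0r.
Qed.

(** In its first argument the commutator is a derivation, and w is central, so divisibility by w
    passes to linear combinations and products. Antisymmetry gives the same for the second argument,
    which reduces the claim to generators. *)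
Lemma commutator_dvd (a b : A) : exists h, commutator a b = w * h.
Proof.
pose P c d := exists h, commutator c d = w * h.
have PZ c (d e f : A) : P d f -> P e f -> P (c *: d + e) f.
  move=> [h Eh] [k Ek]; exists (c *: h + k).
  by rewrite commutatorDl commutatorZl Eh Ek mulrDr scalerAr.
have PM (d e f : A) : P d f -> P e f -> P (d * e) f.
  move=> [h Eh] [k Ek]; exists (d * k + h * e).
  by rewrite commutatorMl Eh Ek mulrDr !mulrA -commutator_central.
have PC (d e : A) : P d e -> P e d.
  by move=> [h Eh]; exists (- h); rewrite commutatorC Eh mulrN.
have P1 (d : A) : P 1 d by exists 0; rewrite commutator1x mulr0.
have Pxy : P x y by exists 1; rewrite mulr1.
have Pxx (d : A) : P d d by exists 0; rewrite commutatorxx mulr0.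
move: b; apply: F23_ind => [||| c d e Pd Pe| d e Pd Pe].
- exact/PC.
- by elim/F23_ind: a => *; [exact: P1|exact: Pxx|exact/PC|exact: PZ|exact: PM].
- by elim/F23_ind: a => *; [exact: P1|exact: Pxy|exact: Pxx|exact: PZ|exact: PM].
- by apply/PC/PZ; exact/PC.
- by apply/PC/PM; exact/PC.
Qed.

(** The difference w[a,b] is a multiple of w^2 = 0. Thus the variables commute behind w. *)
Lemma w_mulC (a b : A) : w * (a * b) = w * (b * a).
Proof.
apply/eqP; rewrite -subr_eq0 -mulrBr -/(commutator a b).
by have [h ->] := commutator_dvd a b; rewrite mulrA commutator_sqr0 mul0r.
Qed.

(** By centrality of w its multiples form a two-sided ideal, which contains all commutators. *)
Lemma T2_dvd (u : A) : T2 K u -> exists h, u = w * h.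
Proof.
move=> /(_ [set a | exists h, a = w * h]); apply; split; last first.
  by move=> _ [a [b ->]]; exact: commutator_dvd.
split=> [|_ _ [h ->] [k ->]|r _ [h ->]|r _ [h ->]] /=.
- by exists 0; rewrite mulr0.
- by exists (h - k); rewrite mulrBr.
- by exists (r * h); rewrite mulrA -commutator_central mulrA.
- by exists (h * r); rewrite mulrA.
Qed.

(** Indices start at 0, so [c i j] is the coefficient of w x^i y^j. *)
Definition fsum (c : nat -> nat -> K) n : A :=
  \sum_(i < n) \sum_(j < n) c i j *: fpoly K i.+1 j.+1.

Lemma fsum_linear k c d n :
  fsum (fun i j => k * c i j + d i j) n = k *: fsum c n + fsum d n.
Proof.
rewrite /fsum scaler_sumr -big_split /=; apply: eq_bigr => i _.
rewrite scaler_sumr -big_split /=; apply: eq_bigr => j _.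
by rewrite scalerDl scalerA.
Qed.

Lemma fsum_delta i j n : (i < n)%N -> (j < n)%N ->
  fsum (fun k l => ((k == i) && (l == j))%:R) n = fpoly K i.+1 j.+1.
Proof.
move=> lti ltj; rewrite /fsum (bigD1 (Ordinal lti)) //=.
rewrite [X in _ + X]big1 => [|k /negPf]; last first.
  rewrite -val_eqE /= => ki; rewrite big1 // => l _.
  by rewrite ki scale0r.
rewrite (bigD1 (Ordinal ltj)) //= !eqxx scale1r big1 ?addr0 // => l /negPf.
by rewrite -val_eqE /= => ->; rewrite scale0r.
Qed.

Lemma T2_fsum (u : A) : T2 K u -> exists c n, u = fsum c n.
Proof.
(* The sum over every range m >= n, so that two such sums can be added. *)
pose D v := exists c n, forall m, (n <= m)%N -> v = fsum c m.
have D0 : D 0.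
  exists (fun _ _ => 0), 0%N => m _; rewrite /fsum big1 // => i _.
  by rewrite big1 // => j _; rewrite scale0r.
have DD k v v' : D v -> D v' -> D (k *: v + v').
  move=> [c [n Dv]] [c' [n' Dv']].
  exists (fun i j => k * c i j + c' i j), (maxn n n') => m.
  by rewrite geq_max fsum_linear => /andP[/Dv <- /Dv' <-].
have Df i j : D (w * (x ^+ i * y ^+ j)).
  exists (fun k l => ((k == i) && (l == j))%:R), (maxn i j).+1 => m.
  by rewrite gtn_max => /andP[im jm]; rewrite fsum_delta // /fpoly mulrA.
(* Induction on r for all i, j at once: in the product case, multiplying by the first factor yields
   new monomials, to which the hypothesis for the second factor applies. *)
have Dw r : forall i j, D (w * (x ^+ i * y ^+ j) * r).
  elim/F23_ind: r => [|||k a b Da Db|a b Da Db] i j.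
  - by rewrite mulr1.
  - by rewrite -mulrA w_mulC mulrA -exprS.
  - by rewrite -!mulrA -exprSr.
  - by rewrite mulrDr -scalerAr; apply: DD.
  - rewrite mulrA; have [c [n /(_ n (leqnn n)) ->]] := Da i j.
    rewrite /fsum mulr_suml; elim/big_rec: _ => // k v _ Dv.
    rewrite mulr_suml; elim/big_rec: _ => [|l v' _]; first by rewrite add0r.
    rewrite -scalerAl /fpoly -mulrA -addrA mulrA -[w * _ * _]mulrA.
    by apply: DD; exact: Db.
move=> /T2_dvd[h ->]; have [c [n Dh]] := Dw h 0%N 0%N.
by exists c, n; rewrite -Dh // !mulr1.
Qed.

End CommutatorIdeal.

(** * Substitutions and homogeneous components in a T-space *)

Section TspaceClosure.
Variables (K : fieldType) (V : set (F23 K)) (VT : Tspace V).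
Local Notation A := (F23 K).
Local Notation x := (xF K).
Local Notation y := (yF K).
Local Notation w := (commutator x y).

Let V0 : V 0. Proof. by case: VT. Qed.

Let VD (c : K) a b : V a -> V b -> V (c *: a + b).
Proof. by case: VT => _ + _; apply. Qed.

Let VZ (c : K) a : V a -> V (c *: a).
Proof. by move=> Va; rewrite -[_ *: _]addr0; apply: VD. Qed.

Lemma Tspace_unscale (c : K) a : c != 0 -> V (c *: a) -> V a.
Proof. by move=> c0 /(VZ c^-1); rewrite scalerA mulVf // scale1r. Qed.

Lemma Tspace_fsum c n :
  (forall i j, (i < n)%N -> (j < n)%N -> V (c i j *: fpoly K i.+1 j.+1)) ->
  V (fsum c n).
Proof.
move=> Vc; have VA a b : V a -> V b -> V (a + b).
  by move=> Va Vb; rewrite -[a]scale1r; apply: VD.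
by apply: (big_ind V) => // i _; apply: (big_ind V) => // j _; exact: Vc.
Qed.

Lemma fpoly_endo (phi : {lrmorphism A -> A}) q1 q2 :
  phi (fpoly K q1 q2) =
    commutator (phi x) (phi y) * phi x ^+ q1.-1 * phi y ^+ q2.-1.
Proof. by rewrite !rmorphM !rmorphXn rmorph_commutator. Qed.

Lemma Tspace_subst (u v : A) q1 q2 : V (fpoly K q1 q2) ->
  V (commutator u v * u ^+ q1.-1 * v ^+ q2.-1).
Proof.
have [phi [phix phiy]] := F23_endo_exists u v.
by case: VT => _ _ /(_ phi) + /[dup] => VE /VE; rewrite fpoly_endo phix phiy.
Qed.

(** Substituting x^m for x gives [x^m,y] = m w x^(m-1), and the exponents add up to (m-1) + m(q1-1)
    = m q1 - 1. *)
Lemma Tspace_pow_x q1 q2 m : (0 < q1)%N -> (0 < m)%N ->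
  V (fpoly K q1 q2) -> V (m%:R *: fpoly K (m * q1) q2).
Proof.
move=> q1_gt0 m_gt0 /(@Tspace_subst (x ^+ m) y); rewrite commutatorXl.
rewrite !mulrnAl scaler_nat -exprM -(mulrA w) -exprD.
suff -> : (m.-1 + m * q1.-1 = (m * q1).-1)%N by [].
by case: q1 q1_gt0 => // q _; case: m m_gt0 => // m _; rewrite mulnS.
Qed.

Lemma Tspace_pow_y q1 q2 m : (0 < q2)%N -> (0 < m)%N ->
  V (fpoly K q1 q2) -> V (m%:R *: fpoly K q1 (m * q2)).
Proof.
move=> q2_gt0 m_gt0 /(@Tspace_subst x (y ^+ m)); rewrite commutatorXr.
(* Here y^(m-1), produced by the commutator, stands before the power of x; behind w the two may be
   exchanged. *)
rewrite !mulrnAl scaler_nat -exprM -(mulrA w) w_mulC mulrA -mulrA -exprD.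
suff -> : (m.-1 + m * q2.-1 = (m * q2).-1)%N by rewrite /fpoly.
by case: q2 q2_gt0 => // q _; case: m m_gt0 => // m _; rewrite mulnS.
Qed.

(** The polynomial is [x^q1 y^(q2-1), y], the image of w under a substitution for x. *)
Lemma Tspace_exact_x q1 q2 : V w -> V (q1%:R *: fpoly K q1 q2).
Proof.
have -> : w = fpoly K 1 1 by rewrite /fpoly !mulr1.
move=> /(@Tspace_subst (x ^+ q1 * y ^+ q2.-1) y); rewrite !mulr1.
rewrite commutatorMl !commutatorXl.
by rewrite commutatorxx mul0r mul0rn mulr0 add0r mulrnAl scaler_nat.
Qed.

(** Symmetrically, the polynomial is [x, x^(q1-1) y^q2]; centrality moves w to the front. *)
Lemma Tspace_exact_y q1 q2 : V w -> V (q2%:R *: fpoly K q1 q2).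
Proof.
have -> : w = fpoly K 1 1 by rewrite /fpoly !mulr1.
move=> /(@Tspace_subst x (x ^+ q1.-1 * y ^+ q2)); rewrite !mulr1.
rewrite commutatorMr !commutatorXr.
rewrite commutatorxx mul0r mul0rn mul0r add0r mulrnAr scaler_nat mulrA.
by rewrite -commutator_central.
Qed.

Hypothesis K_infinite : infinite_set [set: K].

(** The maps [phi t] turn the sum into a pencil in t with coefficients [v i], to which the
    Vandermonde argument applies. *)
Lemma Tspace_eigen (n : nat) (v : nat -> A) (phi : K -> {lrmorphism A -> A}) :
  (forall t i, phi t (v i) = t ^+ i.+1 *: v i) ->
  V (\sum_(i < n) v i) -> forall i, (i < n)%N -> V (v i).
Proof.
(* The weight of [v i] is i+1, so the pencil gets a zero constant coefficient and the others shift
   by one. *)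
move=> phiv Vv i lt_in; pose v' k := if k is k'.+1 then v k' else 0.
apply: (@pencil_coef_mem K A V n.+1 v' _ V0 VD _ i.+1) => // t.
rewrite big_ord_recl scaler0 add0r.
case: VT => _ _ /(_ (phi t) _ Vv); rewrite raddf_sum /=.
by under eq_bigr do rewrite phiv.
Qed.

Lemma fpoly_scale_x (t : K) (phi : {lrmorphism A -> A}) i q2 :
  phi x = t *: x -> phi y = y ->
  phi (fpoly K i.+1 q2) = t ^+ i.+1 *: fpoly K i.+1 q2.
Proof.
move=> phix phiy; rewrite fpoly_endo phix phiy commutatorZl exprZn.
by rewrite -!scalerAl -scalerAr -scalerAl scalerA -exprS.
Qed.

Lemma fpoly_scale_y (t : K) (phi : {lrmorphism A -> A}) q1 j :
  phi x = x -> phi y = t *: y ->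
  phi (fpoly K q1 j.+1) = t ^+ j.+1 *: fpoly K q1 j.+1.
Proof.
move=> phix phiy; rewrite fpoly_endo phix phiy commutatorZr exprZn.
by rewrite -!scalerAl -scalerAr scalerA -exprS.
Qed.

Let scale_x : exists phi : K -> {lrmorphism A -> A},
  forall t, phi t x = t *: x /\ phi t y = y.
Proof.
by have [phi] := choice (fun t => F23_endo_exists (t *: x) y); exists phi.
Qed.

Let scale_y : exists phi : K -> {lrmorphism A -> A},
  forall t, phi t x = x /\ phi t y = t *: y.
Proof.
by have [phi] := choice (fun t => F23_endo_exists x (t *: y)); exists phi.
Qed.

(** Rescaling x isolates the part of given x-degree; rescaling y then splits that part by
    y-degree. *)
Lemma Tspace_homogeneous c n i j : V (fsum c n) -> (i < n)%N -> (j < n)%N ->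
  V (c i j *: fpoly K i.+1 j.+1).
Proof.
have [phi phiE] := scale_x; have [psi psiE] := scale_y => Vc lt_in lt_jn.
apply: (Tspace_eigen (v := fun j => c i j *: fpoly K i.+1 j.+1) (phi := psi)
          (n := n)) => // [t k|].
  rewrite linearZ_LR /= (fpoly_scale_y _ _ (psiE t).1 (psiE t).2).
  by rewrite !scalerA mulrC.
apply: (Tspace_eigen (v := fun i => \sum_(j < n) c i j *: fpoly K i.+1 j.+1)
          (phi := phi) (n := n)) => // t k.
rewrite raddf_sum scaler_sumr; apply: eq_bigr => l _ /=.
rewrite linearZ_LR /= (fpoly_scale_x _ _ (phiE t).1 (phiE t).2).
by rewrite !scalerA mulrC.
Qed.

(** The substitution x + 1 leaves w unchanged, and the terms in the binomial expansion of
    (x+1)^(q1-1) have distinct x-degrees. *)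
Lemma Tspace_translate_x q1 q2 i : (i < q1)%N -> V (fpoly K q1 q2) ->
  V ('C(q1.-1, i)%:R *: fpoly K i.+1 q2).
Proof.
have [phi phiE] := scale_x; case: q1 => // q1 lt_iq.
move=> /(@Tspace_subst (x + 1) y); rewrite commutatorDl commutator1x addr0.
rewrite exprD1n mulr_sumr mulr_suml => Vs.
apply: (Tspace_eigen (n := q1.+1) (phi := phi)
          (v := fun i => 'C(q1, i)%:R *: fpoly K i.+1 q2)) => // [t k|].
  rewrite linearZ_LR /= (fpoly_scale_x _ _ (phiE t).1 (phiE t).2).
  by rewrite !scalerA mulrC.
by under eq_bigr do rewrite scaler_nat /= -mulrnAl -mulrnAr.
Qed.

Lemma Tspace_translate_y q1 q2 j : (j < q2)%N -> V (fpoly K q1 q2) ->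
  V ('C(q2.-1, j)%:R *: fpoly K q1 j.+1).
Proof.
have [phi phiE] := scale_y; case: q2 => // q2 lt_jq.
move=> /(@Tspace_subst x (y + 1)).
rewrite [commutator x _]commutatorC commutatorDl commutator1x addr0.
rewrite -commutatorC exprD1n mulr_sumr => Vs.
apply: (Tspace_eigen (n := q2.+1) (phi := phi)
          (v := fun j => 'C(q2, j)%:R *: fpoly K q1 j.+1)) => // [t k|].
  rewrite linearZ_LR /= (fpoly_scale_y _ _ (phiE t).1 (phiE t).2).
  by rewrite !scalerA mulrC.
by under eq_bigr do rewrite scaler_nat /= -mulrnAr.
Qed.

(** The lowest terms of both translations have binomial coefficient 1. *)
Lemma Tspace_w q1 q2 : (0 < q1)%N -> (0 < q2)%N -> V (fpoly K q1 q2) -> V w.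
Proof.
move=> q1_gt0 q2_gt0 /(Tspace_translate_x q1_gt0).
rewrite bin0 scale1r => /(Tspace_translate_y q2_gt0).
by rewrite bin0 scale1r /fpoly !mulr1.
Qed.

(** Translation in each variable, read at degrees p^a - 1 and p^b - 1, where the binomial
    coefficients are 1 in K. *)
Lemma Tspace_special p a b m n : p \in [pchar K] -> (0 < m)%N -> (0 < n)%N ->
  V (fpoly K (p ^ a * m) (p ^ b * n)) -> V (fpoly K (p ^ a) (p ^ b)).
Proof.
move=> pK; case: m n => [|m] [|n] // _ _.
have p_gt0 := prime_gt0 (pcharf_prime pK).
have q_gt0 c : (0 < p ^ c)%N by rewrite expn_gt0 p_gt0.
have lt_q c k : ((p ^ c).-1 < p ^ c * k.+1)%N.
  by rewrite prednK // leq_pmulr.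
move=> /(Tspace_translate_x (lt_q a m)) /[!bin_pexp_pred] // /[!scale1r].
move=> /(Tspace_translate_y (lt_q b n)) /[!bin_pexp_pred] // /[!scale1r].
by rewrite !prednK.
Qed.

End TspaceClosure.

(** * Generated T-spaces and the generation theorem *)

Lemma Tspace_gen_Tspace (K : fieldType) (A : algType K) (S : set A) :
  Tspace (Tspace_gen S).
Proof.
split=> [J [[]//]|c u v Ju Jv J JS|phi u Ju J JS].
- by case: (JS) => -[_ JD _] _; apply: JD; [exact: Ju|exact: Jv].
- by case: (JS) => -[_ _ JE] _; apply: JE; exact: Ju.
Qed.

Theorem mainTheorem6 (K : fieldType) (p : nat)
    (K_infinite : infinite_set [set: K])
    (K_char : p \in [pchar K]) (p_ge5 : (5 <= p)%N)
    (U : set (F23 K)) (U_Tspace : Tspace U)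
    (U_nonzero : exists2 u, U u & u != 0) (U_sub : U `<=` T2 K) :
  U = Tspace_gen ([set commutator (xF K) (yF K)] `|`
                  [set g | special p g /\ U g]).
Proof.
have p_pr := pcharf_prime K_char.
set S := _ `|` _; set W := Tspace_gen S.
have W_Tspace : Tspace W by exact: Tspace_gen_Tspace.
have SW : S `<=` W by move=> g Sg J [_]; exact.
have Ww : W (commutator (xF K) (yF K)) by apply: SW; left.
apply/seteqP; split; last first.
  (* As U is a T-space, it suffices that U contains the generators; only w needs an argument. *)
  move=> g; apply; split=> // _ [->|[]//].
  have [u Uu u_neq0] := U_nonzero.
  have [c [n uE]] := T2_fsum (U_sub u Uu).
  (* A nonzero coefficient of u would put some f(i+1,j+1), hence w, into U; so without w all
     coefficients vanish and u = 0. *)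
  apply: contrapT => nUw; case/eqP: u_neq0; rewrite uE /fsum.
  rewrite big1 // => i _; rewrite big1 // => j _.
  have [->|cij_neq0] := eqVneq (c i j) 0; first by rewrite scale0r.
  case: nUw; apply: (@Tspace_w _ _ U_Tspace K_infinite i.+1 j.+1) => //.
  apply: (Tspace_unscale U_Tspace cij_neq0).
  by apply: (Tspace_homogeneous U_Tspace K_infinite (n := n)) => //; rewrite -uE.
move=> u Uu; have [c [n uE]] := T2_fsum (U_sub u Uu); rewrite uE.
apply: Tspace_fsum => // i j lt_in lt_jn.
have [->|cij_neq0] := eqVneq (c i j) 0.
  by rewrite scale0r; case: W_Tspace.
have Uij : U (fpoly K i.+1 j.+1).
  apply: (Tspace_unscale U_Tspace cij_neq0).
  by apply: (Tspace_homogeneous U_Tspace K_infinite (n := n)) => //; rewrite -uE.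
suff Wij : W (fpoly K i.+1 j.+1).
  by rewrite -[_ *: _]addr0; case: W_Tspace => W0 WD _; exact: WD.
(* An index prime to p is an invertible scalar of K, and then w alone generates the polynomial. *)
have [p_i|] := boolP (p %| i.+1)%N; last first.
  rewrite (dvdn_pcharf K_char) => i_neq0.
  by apply: (Tspace_unscale W_Tspace i_neq0); exact: (Tspace_exact_x W_Tspace).
have [p_j|] := boolP (p %| j.+1)%N; last first.
  rewrite (dvdn_pcharf K_char) => j_neq0.
  by apply: (Tspace_unscale W_Tspace j_neq0); exact: (Tspace_exact_y W_Tspace).
(* Both indices are now divisible by p; their p-parts are the indices of the special polynomial to
   use. *)
have [m p_m iE] := pfactor_coprime p_pr (ltn0Sn i).
have [r p_r jE] := pfactor_coprime p_pr (ltn0Sn j).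
have m_gt0 : (0 < m)%N by case: m iE {p_m}.
have r_gt0 : (0 < r)%N by case: r jE {p_r}.
have q_gt0 a : (0 < p ^ a)%N by rewrite expn_gt0 prime_gt0.
rewrite prime_coprime // (dvdn_pcharf K_char) in p_m.
rewrite prime_coprime // (dvdn_pcharf K_char) in p_r.
have Wq : W (fpoly K (p ^ logn p i.+1) (p ^ logn p j.+1)).
  apply: SW; right; split.
    exists (logn p i.+1), (logn p j.+1).
    (* Divisibility by p makes both exponents at least 1, as required for a special polynomial. *)
    by rewrite -!pfactor_dvdn // !expn1.
  apply: (@Tspace_special _ _ U_Tspace K_infinite p _ _ m r) => //.
  by rewrite ![(p ^ _ * _)%N]mulnC -iE -jE.
(* Substituting x^m and y^r recovers the polynomial up to the scalars m and r, which are nonzero in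
   K. *)
rewrite iE jE; apply: (Tspace_unscale W_Tspace p_m).
apply: (Tspace_pow_x W_Tspace) => //; apply: (Tspace_unscale W_Tspace p_r).
exact: (Tspace_pow_y W_Tspace).
Qed.
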